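(* Let $G=(G_l,\ldots,G_1)$ be a polynomial resolution. Then $G$ has the PD (predictable degree) property if and only if $G$ is (column) reduced.
   Context: Setting. $\mathbb F$ is an arbitrary field, $n\ge 1$ an integer, $D=(D_1,\ldots,D_n)$ indeterminates, $S=\mathbb F[D]$. $S_{\le d}$ is the space of polynomials of (total) degree $\le d$ ($d\in\mathbb Z$). All polynomial matrices considered are assumed to have no zero column. Degrees. A twisting (degree) function of length $p$ is a function $a:[1,p]=\{1,\ldots,p\}\to\mathbb Z_+=\{0,1,2,\ldots\}$. For $f\in S^p$, $\deg_a(f)=\max_i\{a(i)+\deg(f_i)\}$ (and $-\infty$ if $f=0$). For $G\in S^{p\times q}$ with no zero column, $\deg_a(G):[1,q]\to\mathbb Z_+$ sends $j$ to the $a$-degree of the $j$-th column of $G$. Polynomial complexes. A polynomial complex of length $l\ge 1$ and size $q\times(p_l,\ldots,p_1)$ ($p_i\geq 1$) is a sequence $(G_l,\ldots,G_1)$ of matrices over $S$, where $G_1$ is $q\times p_1$ and $G_i$ is $p_{i-1}\times p_i$ for $i\ge2$, such that $G_1G_2=0,\ldots,G_{l-1}G_l=0$. It is a polynomial resolution if $0\to S^{p_l}\xrightarrow{G_l}\cdots\to S^{p_1}\xrightarrow{G_1}S^q$ is exact (at every term except $S^q$). Its column degree table $(a_l,\ldots,a_1)$ is defined recursively by $a_0=0$ (the zero function on $[1,q]$; put $p_0=q$) and $a_{i+1}=\deg_{a_i}(G_{i+1})$, a twisting function of length $p_{i+1}$. PD property. For a twisting function $a$ of length $p$ and $d\ge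 0$ let $S^p[-a]_{\le d}=\{f\in S^p:\deg_a(f)\le d\}$. For a submodule $C\subseteq S^q$ let $C_{\le d}=C\cap (S_{\le d})^q$. A polynomial complex $G=(G_l,\ldots,G_1)$ of size $q\times(p_l,\ldots,p_1)$ with column degree table $(a_l,\ldots,a_1)$, and with $C=\mathrm{Im}(G_1)$, has the PD property if for every $d\ge0$ the sequence of $\mathbb F$-vector spaces $$0\to S^{p_l}[-a_l]_{\le d}\xrightarrow{G_l}\cdots\xrightarrow{G_2}S^{p_1}[-a_1]_{\le d}\xrightarrow{G_1}C_{\le d}\to0$$ is exact (at every term). Reducedness. For a twisting function $a$ of length $p$, $S^p(-a)$ is the module $S^p$ with the gradation $S^p(-a)_d=\{f\in S^p: f_i \text{ is homogeneous of degree } d-a(i) \text{ or zero, for all } i\}$, $d\ge0$. For a polynomial complex $G$, let $G_k^L$ be the matrix over $S$ of the same size as $G_k$ whose $(i,j)$ entry is the homogeneous part of degree $a_k(j)-a_{k-1}(i)$ of the $(i,j)$ entry of $G_k$ (zero if this number is negative). $G$ is (column) reduced if the complex of graded modules $$0\to S^{p_l}(-a_l)\xrightarrow{G_l^L}\cdots\xrightarrow{G_2^L}S^{p_1}(-a_1)\xrightarrow{G_1^L}S^q(0)$$ is exact (at every term except $S^q$). *)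

(* Defs.v *)
(* S = F[D_1, ..., D_n] is {mpoly F[n]}. *)
From HB Require Import structures.
From mathcomp Require Import all_boot all_order all_algebra.
From mathcomp Require Export mpoly.

Set Implicit Arguments.
Unset Strict Implicit.
Unset Printing Implicit Defensive.

Import GRing.Theory.
Local Open Scope ring_scope.

(* A sequence (G_l, ..., G_1) of sizes p_0 = q, p_1, ..., p_l is encoded by
   nat-indexed families p and G, where G i stands for G_(i+1), of size
   p_i x p_(i+1).  Only p 0, ..., p l and G 0, ..., G l.-1 are ever
   constrained or used; all later values are irrelevant.  Elements of S^p are
   column vectors, on which matrices act by left multiplication. *)

Section Degrees.
Variables (F : fieldType) (n : nat).
Local Notation S := {mpoly F[n]}.

(* 1 + deg_a(f), and 0 if f = 0 (i.e. if deg_a(f) is -oo): the convention of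
   msize.  Hence deg_a(f) <= d is written twsize a f <= d.+1. *)
Definition twsize (p : nat) (a : 'I_p -> nat) (f : 'cV[S]_p) : nat :=
  (\max_(i < p | f i ord0 != 0%R) (a i + msize (f i ord0)))%N.

(* The predecessor is the actual degree, as columns are assumed nonzero. *)
Definition twdeg (p q : nat) (a : 'I_p -> nat) (G : 'M[S]_(p, q)) :
    'I_q -> nat :=
  fun j => (twsize a (col j G)).-1.

(* S^p[-a]_{<= d} *)
Definition tw_le (p : nat) (a : 'I_p -> nat) (d : nat) (f : 'cV[S]_p) : Prop :=
  (twsize a f <= d.+1)%N.

(* S^p(-a)_d; note that 0 is k.-homog for every k. *)
Definition tw_homog (p : nat) (a : 'I_p -> nat) (d : nat) (f : 'cV[S]_p) :
    Prop :=
  forall i, if (a i <= d)%N then f i ord0 \is (d - a i).-homog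
            else f i ord0 == 0.

(* C_{<= d} for C = Im(G) *)
Definition im_le (q p : nat) (G : 'M[S]_(q, p)) (d : nat) (c : 'cV[S]_q) :
    Prop :=
  (exists f : 'cV[S]_p, G *m f = c) /\
  (forall i, msize (c i ord0) <= d.+1)%N.

End Degrees.

Section Complexes.
Variables (F : fieldType) (n : nat) (l : nat) (p : nat -> nat).
Local Notation S := {mpoly F[n]}.
Implicit Types (G : forall i, 'M[S]_(p i, p i.+1)).

(* Exactness of 0 -> V_l -> ... -> V_1 -> V_0 at V_1, ..., V_l, where V_i is a
   subspace of S^(p_i) and the maps are the restrictions of the G_i (which have
   to be well defined); nothing is required at V_0. *)
Definition exact_seq (V : forall i, 'cV[S]_(p i) -> Prop) G : Prop :=
  [/\ forall i, (i < l)%N -> forall f, V i.+1 f -> V i (G i *m f),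
      forall i, (i.+1 < l)%N -> forall f, V i.+1 f ->
        (G i *m f = 0 <-> exists2 g, V i.+2 g & G i.+1 *m g = f)
    & forall i, i.+1 = l -> forall f, V i.+1 f -> G i *m f = 0 -> f = 0].

(* Exactness of the sequence of the full modules S^(p_i), except at S^(p_0). *)
Definition module_exact G : Prop := exact_seq (fun _ _ => True) G.

Definition polynomial_complex G : Prop :=
  [/\ (0 < l)%N,
      forall i, (i < l)%N -> (0 < p i.+1)%N,
      forall i, (i < l)%N -> forall j, col j (G i) != 0
    & forall i, (i.+1 < l)%N -> G i *m G i.+1 = 0].

Definition polynomial_resolution G : Prop :=
  polynomial_complex G /\ module_exact G.

(* The column degree table, together with a_0 = 0. *)
Fixpoint coldeg G (i : nat) : 'I_(p i) -> nat :=
  match i return 'I_(p i) -> nat with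
  | 0 => fun _ => 0%N
  | k.+1 => twdeg (@coldeg G k) (G k)
  end.

Definition pd_term G (d : nat) (i : nat) : 'cV[S]_(p i) -> Prop :=
  match i return 'cV[S]_(p i) -> Prop with
  | 0 => im_le (G 0%N) d
  | k.+1 => tw_le (@coldeg G k.+1) d
  end.

(* The second conjunct is exactness at C_{<= d}. *)
Definition PD_property G : Prop :=
  forall d : nat,
    exact_seq (@pd_term G d) G /\
    (forall c, @pd_term G d 0 c ->
       exists2 f, @pd_term G d 1 f & G 0%N *m f = c).

Definition lead G (i : nat) : 'M[S]_(p i, p i.+1) :=
  \matrix_(r, c)
    if (@coldeg G i r <= @coldeg G i.+1 c)%N
    then pihomog mdeg (@coldeg G i.+1 c - @coldeg G i r) (G i r c)
    else 0.

(* The matrices G_i^L are graded maps S^(p_i)(-a_i) -> S^(p_(i-1))(-a_(i-1)),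
   and the sequence of modules they form is exact. *)
Definition column_reduced G : Prop :=
  (forall d i, (i < l)%N -> forall f,
     tw_homog (@coldeg G i.+1) d f -> tw_homog (@coldeg G i) d (lead G i *m f))
  /\ module_exact (lead G).

End Complexes.

(* Main.v *)
(* Call G_i strict if every G_i f of degree <= e equals G_i g for some g of
   degree <= e.  For a resolution, both properties are equivalent to strictness
   of all G_i.  The link is that the degree d part of G_i f, for f of degree
   <= d, is G_i^L applied to the degree d part of f.  If G is reduced and
   deg (G_i f) < d = deg f, the top part of f is thus killed by G_i^L, hence
   equal to G_(i+1)^L h with h homogeneous of degree d, and subtracting
   G_(i+1) h from f lowers its degree.  Conversely, if f is homogeneous of
   degree d and G_i^L f = 0, then deg (G_i f) < d, so G_i f = G_i g with
   deg g < d; now f - g = G_(i+1) h with deg h <= d, and taking parts of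
   degree d yields f = G_(i+1)^L h_d. *)
Require Import Defs.
From mathcomp Require Import all_boot all_order all_algebra.
From mathcomp Require Import zify.

Set Implicit Arguments.
Unset Strict Implicit.
Unset Printing Implicit Defensive.

Import GRing.Theory.
Local Open Scope ring_scope.

(** * Coefficients of homogeneous parts *)

Lemma mcoeff_pihomog (n : nat) (R : nzRingType) (d : nat) (f : {mpoly R[n]})
    (m : 'X_{1..n}) :
  (pihomog mdeg d f)@_m = if mdeg m == d then f@_m else 0.
Proof.
rewrite pihomogE raddf_sum /=.
under eq_bigr do rewrite mcoeffZ mcoeffX.
have [mf|mNf] := boolP (m \in msupp f); last first.
  rewrite memN_msupp_eq0 // if_same big_seq_cond big1 // => k /andP[kf _].
  case: (k =P m) => [km|_]; last by rewrite mulr0.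
  by rewrite -km kf in mNf.
rewrite big_mkcond /= (bigD1_seq m) ?msupp_uniq //= eqxx mulr1 big1 ?addr0 //.
by move=> k /negPf->; rewrite mulr0 if_same.
Qed.

Lemma msize_leP (n : nat) (R : nzRingType) (f : {mpoly R[n]}) (e : nat) :
  reflect (forall m, f@_m != 0 -> (mdeg m < e)%N) (msize f <= e)%N.
Proof.
apply: (iffP idP) => [fe m|fe].
  by rewrite -mcoeff_msupp => /msize_mdeg_lt/leq_trans; apply.
rewrite msizeE big_seq; elim/big_ind: _ => // [x y|m].
  by rewrite geq_max => -> ->.
by rewrite mcoeff_msupp => /fe.
Qed.

(** * Twisted degrees and homogeneous parts of vectors *)

Section TwistedDegree.
Variables (F : fieldType) (n : nat).
Local Notation S := {mpoly F[n]}.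

Lemma cvmP (p : nat) (f g : 'cV[S]_p) :
  (forall i m, (f i ord0)@_m = (g i ord0)@_m) -> f = g.
Proof. by move=> fg; apply/colP => i; apply/mpolyP => m; apply: fg. Qed.

Lemma twsize_leP (p : nat) (a : 'I_p -> nat) (f : 'cV[S]_p) (e : nat) :
  reflect (forall i m, (f i ord0)@_m != 0 -> (a i + mdeg m < e)%N)
          (twsize a f <= e)%N.
Proof.
rewrite /twsize; apply: (iffP (bigmax_leqP _ _ _)) => [fe i m fm|fe i fi0].
  have fi0 : f i ord0 != 0 by apply: contraNneq fm => ->; rewrite mcoeff0.
  apply: leq_trans (fe i fi0); rewrite ltn_add2l.
  by rewrite msize_mdeg_lt // mcoeff_msupp.
have [m mf] : exists m, m \in msupp (f i ord0).
  case E: (msupp (f i ord0)) => [|m s]; last by exists m; rewrite mem_head.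
  by move/eqP: E fi0; rewrite msupp_eq0 => ->.
have ae : (a i <= e)%N.
  by move: mf; rewrite mcoeff_msupp => /fe /ltnW; apply/leq_trans/leq_addr.
rewrite -(subnKC ae) leq_add2l; apply/msize_leP => k /fe.
by rewrite ltn_subRL.
Qed.

Lemma twsize_mcoeff (p : nat) (a : 'I_p -> nat) (f : 'cV[S]_p) i m :
  (f i ord0)@_m != 0 -> (a i + mdeg m < twsize a f)%N.
Proof. by move: i m; apply/twsize_leP. Qed.

Lemma twsize0_eq0 (p : nat) (a : 'I_p -> nat) (f : 'cV[S]_p) :
  (twsize a f <= 0)%N -> f = 0.
Proof.
move/twsize_leP=> f0; apply: cvmP => i m; rewrite mxE mcoeff0.
by apply/eqP/negPn/negP => /f0.
Qed.

Lemma twsize0 (p : nat) (a : 'I_p -> nat) e : (twsize a (0 : 'cV[S]_p) <= e)%N.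
Proof. by apply/twsize_leP => i m; rewrite mxE mcoeff0 eqxx. Qed.

Lemma twsizeB (p : nat) (a : 'I_p -> nat) (f g : 'cV[S]_p) e :
  (twsize a f <= e)%N -> (twsize a g <= e)%N -> (twsize a (f - g) <= e)%N.
Proof.
move=> /twsize_leP fe /twsize_leP ge; apply/twsize_leP => i m.
rewrite !mxE mcoeffB; have [->|/fe //] := eqVneq ((f i ord0)@_m) 0.
by rewrite sub0r oppr_eq0 => /ge.
Qed.

(** The projection of S^p(-a) onto its degree [d] component. The test [a i <= d] matters: truncated
    subtraction would otherwise keep constant terms. *)
Definition twpart (p : nat) (a : 'I_p -> nat) (d : nat) (f : 'cV[S]_p) :
    'cV[S]_p :=
  \col_i if (a i <= d)%N then pihomog mdeg (d - a i) (f i ord0) else 0.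

Lemma twpartE (p : nat) (a : 'I_p -> nat) d (f : 'cV[S]_p) i m :
  (twpart a d f i ord0)@_m = if (a i + mdeg m == d)%N then (f i ord0)@_m else 0.
Proof.
rewrite mxE; case: leqP => [ad|da]; last first.
  by rewrite mcoeff0 gtn_eqF // ltn_addr.
by rewrite mcoeff_pihomog -{2}(subnKC ad) eqn_add2l.
Qed.

Lemma twpart0 (p : nat) (a : 'I_p -> nat) d : twpart a d (0 : 'cV[S]_p) = 0.
Proof. by apply: cvmP => i m; rewrite twpartE mxE mcoeff0 if_same. Qed.

Lemma twpartB (p : nat) (a : 'I_p -> nat) d (f g : 'cV[S]_p) :
  twpart a d (f - g) = twpart a d f - twpart a d g.
Proof.
have subE (u v : 'cV[S]_p) i m :
    ((u - v) i ord0)@_m = (u i ord0)@_m - (v i ord0)@_m.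
  by rewrite !mxE mcoeffB.
apply: cvmP => i m; rewrite subE !twpartE subE.
by case: ifP; rewrite ?subr0.
Qed.

Lemma twsize_twpart (p : nat) (a : 'I_p -> nat) d (f : 'cV[S]_p) :
  (twsize a (twpart a d f) <= d.+1)%N.
Proof.
apply/twsize_leP => i m.
by rewrite twpartE; case: (_ =P d) => [->|]; rewrite ?eqxx.
Qed.

Lemma twpart_id (p : nat) (a : 'I_p -> nat) d (f : 'cV[S]_p) :
  twpart a d (twpart a d f) = twpart a d f.
Proof. by apply: cvmP => i m; rewrite !twpartE; case: (_ == d). Qed.

Lemma twpart_eq0 (p : nat) (a : 'I_p -> nat) d (f : 'cV[S]_p) :
  (twsize a f <= d)%N -> twpart a d f = 0.
Proof.
move=> /twsize_leP fd; apply: cvmP => i m; rewrite twpartE mxE mcoeff0.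
case: eqP => // E; apply/eqP; move: (fd i m); rewrite E ltnn.
by case: eqP => // _ /(_ isT).
Qed.

Lemma twsize_drop (p : nat) (a : 'I_p -> nat) d (f : 'cV[S]_p) :
  (twsize a f <= d.+1)%N -> twpart a d f = 0 -> (twsize a f <= d)%N.
Proof.
move=> /twsize_leP fd fd0; apply/twsize_leP => i m fm.
have := fd i m fm; rewrite ltnS leq_eqVlt => /orP[E|//].
have := twpartE a d f i m.
by rewrite E fd0 mxE mcoeff0 => E0; rewrite -E0 eqxx in fm.
Qed.

Lemma sum_twpart (p : nat) (a : 'I_p -> nat) (f : 'cV[S]_p) :
  f = \sum_(d < twsize a f) twpart a d f.
Proof.
apply: cvmP => i m; rewrite summxE raddf_sum /=.
under eq_bigr do rewrite twpartE.
have [f0|fm] := eqVneq ((f i ord0)@_m) 0.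
  by rewrite f0 big1 // => d _; rewrite if_same.
pose d := Ordinal (twsize_mcoeff a fm).
rewrite (bigD1 d) //= eqxx big1 ?addr0 // => j.
by rewrite -val_eqE /= eq_sym => /negPf->.
Qed.

Lemma tw_homogP (p : nat) (a : 'I_p -> nat) d (f : 'cV[S]_p) :
  tw_homog a d f <-> twpart a d f = f.
Proof.
split=> [fd|<- i]; last first.
  by rewrite mxE; case: (_ <= d)%N => //; apply: pihomogP.
apply/colP => i; rewrite mxE; have := fd i.
by case: ifP => _ => [/pihomog_dE|/eqP].
Qed.

(** * Matrices acting on twisted degrees *)

Section Multiplication.
Variables (p q : nat) (a : 'I_p -> nat) (b : 'I_q -> nat).

Lemma mcoeff_mulmx (G : 'M[S]_(p, q)) (f : 'cV[S]_q) i m :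
  ((G *m f) i ord0)@_m =
  \sum_j \sum_(k : 'X_{1..n < (mdeg m).+1, (mdeg m).+1} | m == (k.1 + k.2)%MM)
     (G i j)@_k.1 * (f j ord0)@_k.2.
Proof.
by rewrite mxE raddf_sum; apply: eq_bigr => j _; rewrite /= mcoeffM.
Qed.

Lemma twsize_mulmx (G : 'M[S]_(p, q)) (f : 'cV[S]_q) e :
    (forall i j m, (G i j)@_m != 0 -> (a i + mdeg m <= b j)%N) ->
  (twsize b f <= e)%N -> (twsize a (G *m f) <= e)%N.
Proof.
move=> Gab /twsize_leP fe; apply/twsize_leP => i m; apply: contraNT => aie.
rewrite mcoeff_mulmx big1 // => j _; rewrite big1 // => k /eqP mk.
have [->|/Gab ak] := eqVneq ((G i j)@_k.1) 0; first by rewrite mul0r.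
have [->|/fe bk] := eqVneq ((f j ord0)@_k.2) 0; first by rewrite mulr0.
by case/negP: aie; rewrite mk mdegD addnA (leq_ltn_trans _ bk) // leq_add2r.
Qed.

(** [lead] for arbitrary twists [a] and [b]. *)
Definition twlead (G : 'M[S]_(p, q)) : 'M[S]_(p, q) :=
  \matrix_(i, j)
    if (a i <= b j)%N then pihomog mdeg (b j - a i) (G i j) else 0.

Lemma twleadE (G : 'M[S]_(p, q)) i j m :
  (twlead G i j)@_m = if (a i + mdeg m == b j)%N then (G i j)@_m else 0.
Proof.
rewrite mxE; case: leqP => [ab|ba]; last first.
  by rewrite mcoeff0 gtn_eqF // ltn_addr.
by rewrite mcoeff_pihomog -{2}(subnKC ab) eqn_add2l.
Qed.

(** A product of a monomial of [G i j] and one of [f j] has twisted degree at most [d]; equality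
    forces both factors to have their maximal degrees ([sqz]). *)
Lemma twlead_twpart (G : 'M[S]_(p, q)) (f : 'cV[S]_q) d :
    (forall i j m, (G i j)@_m != 0 -> (a i + mdeg m <= b j)%N) ->
  (twsize b f <= d.+1)%N -> twlead G *m twpart b d f = twpart a d (G *m f).
Proof.
have sqz x y z c : (x + y <= z -> z + c < d.+1 -> x + (y + c) = d ->
    (x + y == z) /\ (z + c == d))%N by lia.
move=> Gab /twsize_leP fd; apply: cvmP => i m; rewrite twpartE !mcoeff_mulmx.
case: eqP => mad; last first.
  rewrite big1 // => j _; rewrite big1 // => k /eqP mk; rewrite twleadE twpartE.
  case: eqP => [ak|]; last by rewrite mul0r.
  case: eqP => [bk|]; last by rewrite mulr0.
  by case: mad; rewrite mk mdegD addnA ak.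
apply: eq_bigr => j _; apply: eq_bigr => k /eqP mk; rewrite twleadE twpartE.
have [->|/Gab ak] := eqVneq ((G i j)@_k.1) 0; first by rewrite if_same !mul0r.
have [->|/fd bk] := eqVneq ((f j ord0)@_k.2) 0; first by rewrite if_same !mulr0.
have mkd : (a i + (mdeg k.1 + mdeg k.2) = d)%N by rewrite -mdegD -mk.
by have [-> ->] := sqz _ _ _ _ ak bk mkd.
Qed.

(** No bound on [f] is needed here, since all monomials of [twlead G] have the exact degree that
    makes it a graded map. *)
Lemma twpart_twlead (G : 'M[S]_(p, q)) (f : 'cV[S]_q) d :
  twpart a d (twlead G *m f) = twlead G *m twpart b d f.
Proof.
apply: cvmP => i m; rewrite twpartE !mcoeff_mulmx; case: eqP => mad; last first.
  rewrite big1 // => j _; rewrite big1 // => k /eqP mk; rewrite twleadE twpartE.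
  case: eqP => [ak|]; last by rewrite mul0r.
  case: eqP => [bk|]; last by rewrite mulr0.
  by case: mad; rewrite mk mdegD addnA ak.
apply: eq_bigr => j _; apply: eq_bigr => k /eqP mk; rewrite twleadE twpartE.
case: eqP => [ak|]; last by rewrite !mul0r.
by rewrite ifT // -ak -addnA -mdegD -mk mad.
Qed.

End Multiplication.

Lemma twdeg_mcoeff (p q : nat) (a : 'I_p -> nat) (G : 'M[S]_(p, q)) i j m :
  (G i j)@_m != 0 -> (a i + mdeg m <= twdeg a G j)%N.
Proof.
move=> Gm; have := @twsize_mcoeff p a (col j G) i m; rewrite mxE => /(_ Gm).
by rewrite /twdeg; case: twsize.
Qed.

End TwistedDegree.

(** * Strictness, predictable degrees and reducedness *)

Section Complex.
Variables (F : fieldType) (n l : nat) (p : nat -> nat).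
Variable G : forall i, 'M[{mpoly F[n]}]_(p i, p i.+1).
Arguments coldeg {F n p} G i.

Lemma twsize_coldeg i f e :
  (twsize (coldeg G i.+1) f <= e)%N -> (twsize (coldeg G i) (G i *m f) <= e)%N.
Proof. by apply: twsize_mulmx => r c m; apply: twdeg_mcoeff. Qed.

Lemma lead_twpart i f d : (twsize (coldeg G i.+1) f <= d.+1)%N ->
  lead G i *m twpart (coldeg G i.+1) d f = twpart (coldeg G i) d (G i *m f).
Proof. by apply: twlead_twpart => r c m; apply: twdeg_mcoeff. Qed.

Lemma twpart_lead i f d :
  twpart (coldeg G i) d (lead G i *m f) =
  lead G i *m twpart (coldeg G i.+1) d f.
Proof. exact: twpart_twlead. Qed.

Lemma coldeg0_msize d (c : 'cV[{mpoly F[n]}]_(p 0)) :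
  (twsize (coldeg G 0) c <= d)%N <-> forall i, (msize (c i ord0) <= d)%N.
Proof.
split=> [/twsize_leP cd i|cd]; first by apply/msize_leP => m /cd.
by apply/twsize_leP => i m cm; apply: (msize_leP _ _ (cd i)).
Qed.

(** Strictness for the degree filtrations. The bound [e] is a size: [d.+1] means degree at most [d],
    and 0 means a zero vector. *)
Definition strict i := forall e f, (twsize (coldeg G i) (G i *m f) <= e)%N ->
  exists2 g, (twsize (coldeg G i.+1) g <= e)%N & G i *m g = G i *m f.

Hypothesis Gres : polynomial_resolution l G.

Lemma PD_strict i : PD_property l G -> (i < l)%N -> strict i.
Proof.
case: Gres => [[_ _ _ GG0] [_ Gex _]] PD il [|d] f Gf.
  (* Size bound 0 lies below the range of the PD property, but here [G i *m f] vanishes. *)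
  by exists 0; rewrite ?twsize0 // (twsize0_eq0 Gf) mulmx0.
case: i il f Gf => [|i] il f Gf.
  have [_] := PD d; apply; split; first by exists f.
  by apply/coldeg0_msize.
(* [G i.+1 *m f] is a cycle of degree at most [d], so exactness in that degree yields the
   preimage. *)
have [[_ + _] _] := PD d => /(_ i il (G i.+1 *m f) Gf)[+ _].
by apply; rewrite mulmxA GG0 // mul0mx.
Qed.

Lemma strict_PD : (forall i, (i < l)%N -> strict i) -> PD_property l G.
Proof.
case: Gres => [[l0 _ _ GG0] [_ Gex Ginj]] Gst d; split; last first.
  move=> _ [[f <-] /coldeg0_msize fd]; have [g gd Gg] := Gst 0%N l0 _ _ fd.
  by exists g.
split=> [i il f fd|i il f fd|i il f _ Gf]; last by apply: Ginj il _ _ Gf.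
  have {}fd := twsize_coldeg fd; case: i il f fd => // il f fd.
  by split; [exists f | apply/coldeg0_msize].
split=> [Gf|[g _ <-]]; last by rewrite mulmxA GG0 // mul0mx.
(* Exactness of the resolution gives a preimage [g] of unknown degree; strictness trades it for one
   within the bound. *)
have [+ _] := Gex _ il f I => /(_ Gf)[g _ gf].
have [|h hd hf] := Gst _ il d.+1 g; first by rewrite gf.
by exists h => //; rewrite hf.
Qed.

Lemma reduced_strict i : column_reduced l G -> (i < l)%N -> strict i.
Proof.
case: Gres => [[_ _ _ GG0] _] [_ [_ Lex Linj]] il e f Gf.
have [d fd] := ubnP (twsize (coldeg G i.+1) f).
(* Induction on a bound for the size of [f]: while it exceeds [e], the top part of [f] can be
   removed. *)
elim: d => [|d IHd] // in f Gf fd *; rewrite ltnS in fd.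
have [de|ed] := leqP d e; first by exists f => //; apply: leq_trans de.
case: d => [|d] // in IHd fd ed *.
have Lf : lead G i *m twpart (coldeg G i.+1) d f = 0.
  by rewrite lead_twpart // twpart_eq0 // (leq_trans Gf).
(* At the last matrix, injectivity of [lead G i] already makes the top part zero. *)
move: il; rewrite leq_eqVlt => /orP[/eqP il|il].
  by apply: IHd => //; apply: (twsize_drop fd); apply: Linj Lf.
have [+ _] := Lex _ il (twpart (coldeg G i.+1) d f) I => /(_ Lf)[h _ hf].
(* Exactness need not give a homogeneous [h]; its degree [d] part has the same image, as [lead] is
   graded. *)
pose g := twpart (coldeg G i.+2) d h.
have GGg : G i *m (G i.+1 *m g) = 0 by rewrite mulmxA GG0 // mul0mx.
have gd : (twsize (coldeg G i.+2) g <= d.+1)%N by apply: twsize_twpart.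
case: (IHd (f - G i.+1 *m g)).
- by rewrite mulmxBr GGg subr0.
- apply: twsize_drop; first by apply: twsizeB => //; apply: twsize_coldeg.
  by rewrite twpartB -lead_twpart // twpart_id -twpart_lead hf twpart_id subrr.
- by move=> k ke; rewrite mulmxBr GGg subr0; exists k.
Qed.

(** Each homogeneous part of a syzygy of [lead G i] lifts to a syzygy of [G i] with that top part:
    strictness supplies a correction of lower degree. *)
Lemma lead_twpart_eq0 i f d : (i < l)%N -> strict i ->
    lead G i *m f = 0 ->
  exists2 k, G i *m k = 0 & (twsize (coldeg G i.+1) k <= d.+1)%N /\
    twpart (coldeg G i.+1) d k = twpart (coldeg G i.+1) d f.
Proof.
move=> il Gi Lf; pose fd := twpart (coldeg G i.+1) d f.
have fdd : (twsize (coldeg G i.+1) fd <= d.+1)%N by apply: twsize_twpart.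
have Gfd : (twsize (coldeg G i) (G i *m fd) <= d)%N.
  apply: twsize_drop; first exact: twsize_coldeg.
  by rewrite -lead_twpart // twpart_id -twpart_lead Lf twpart0.
have [g gd Gg] := Gi _ _ Gfd.
exists (fd - g); first by rewrite mulmxBr Gg subrr.
split; first by apply: twsizeB => //; apply: leqW.
by rewrite twpartB (twpart_eq0 gd) subr0 twpart_id.
Qed.

Lemma strict_reduced :
  (forall i, (i < l)%N -> strict i) -> column_reduced l G.
Proof.
case: Gres => [[l0 _ _ GG0] [_ Gex Ginj]] Gst.
split=> [d i il f /tw_homogP fd|].
  by apply/tw_homogP; rewrite twpart_lead fd.
split=> // [i il f _|i il f _ Lf]; last first.
  (* Each part of [f] is the top part of a syzygy of the injective last matrix, hence zero. *)
  rewrite (sum_twpart (coldeg G i.+1) f) big1 // => d _.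
  have il' : (i < l)%N by rewrite -il.
  have [k Gk [_ <-]] := lead_twpart_eq0 d il' (Gst i il') Lf.
  by rewrite (Ginj _ il k I Gk) twpart0.
split=> [Lf|[g _ <-]]; last first.
  (* On a homogeneous part of [g], the two leading matrices compose to the top part of the image
     under [G i *m G i.+1], which is zero. *)
  rewrite (sum_twpart (coldeg G i.+2) g) !mulmx_sumr big1 // => d _.
  rewrite -(twpart_id _ d g) lead_twpart ?twsize_twpart //.
  rewrite lead_twpart ?twsize_coldeg ?twsize_twpart //.
  by rewrite mulmxA GG0 // mul0mx twpart0.
(* Preimages of the finitely many homogeneous parts of [f] add up to a preimage of [f]. *)
suff /fin_all_exists[h hf] : forall d : 'I_(twsize (coldeg G i.+1) f),
    exists h, lead G i.+1 *m h = twpart (coldeg G i.+1) d f.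
  exists (\sum_d h d) => //; rewrite mulmx_sumr (eq_bigr _ (fun d _ => hf d)).
  by rewrite -sum_twpart.
move=> d; have il' := ltnW il.
have [k Gk [kd <-]] := lead_twpart_eq0 d il' (Gst i il') Lf.
have [+ _] := Gex _ il k I => /(_ Gk)[g _ gk].
(* Strictness of the next matrix bounds the preimage of [k], as [lead_twpart] requires. *)
have [|h hd hk] := Gst _ il d.+1 g; first by rewrite gk.
by exists (twpart (coldeg G i.+2) d h); rewrite lead_twpart // hk gk.
Qed.

End Complex.

Theorem corollary1 (F : fieldType) (n : nat) (hn : (0 < n)%N)
    (l : nat) (p : nat -> nat)
    (G : forall i : nat, 'M[{mpoly F[n]}]_(p i, p i.+1))
    (Gres : polynomial_resolution l G) :
  PD_property l G <-> column_reduced l G.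
Proof.
split=> H; [apply: strict_reduced | apply: strict_PD] => // i il.
  exact: PD_strict H il.
exact: reduced_strict H il.
Qed.
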